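(* Let $X$ be a Banach space, $Y$ an ordered Banach space with closed positive cone, and $S: D(S)\subset X\to Y$ a closed linear operator. Let $(A,D(A))$ be the generator of a strongly continuous semigroup $(e^{tA})_{t\ge 0}$ on $X$, and let $V:[0,\infty)\to\mathcal{L}(X)$ be a strongly continuous family of bounded linear operators such that there exist $M\ge 1$ and $\omega\in\mathbb{R}$ with $$\|V(t)^n\|\le M e^{tn\omega}\qquad\text{for all } t\ge 0,\ n\in\mathbb{N},$$ and such that there is a core $D\subset D(A)$ of $A$ for which the limit $$\lim_{h\downarrow 0}\frac{V(h)x-x}{h}=Ax$$ exists (and equals $Ax$) for all $x\in D$. If $C=C_A$ and $V(t)C\subset C$ for all $t\ge 0$, then $(e^{tA})_{t\ge 0}$ is $S$-shape preserving.
   Context: For a closed operator $S:D(S)\subset X\to Y$ put $C:=\overline{\{x\in D(S): Sx\ge 0\}}$, and for a generator $(A,D(A))$ of a strongly continuous semigroup on $X$ put $C_A:=\overline{\{x\in D(A)\cap D(S): Sx\ge 0\}}$ (closures in $X$). The semigroup $(e^{tA})_{t\ge0}$ is called $S$-shape preserving if (a) $C=C_A$ and (b) $e^{tA}C\subset C$ for all $t\ge 0$. *)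

(* Defs.v *)
From HB Require Import structures.
From mathcomp Require Import all_boot all_order all_algebra.
From mathcomp Require Import all_classical all_reals all_analysis.

Set Implicit Arguments.
Unset Strict Implicit.
Unset Printing Implicit Defensive.

Import Order.TTheory GRing.Theory Num.Theory.
Import numFieldNormedType.Exports.

Local Open Scope classical_set_scope.
Local Open Scope ring_scope.

Definition is_subspace (R : realType) (X : normedModType R) (D : set X) : Prop :=
  D 0 /\ forall (a : R) (x y : X), D x -> D y -> D (a *: x + y).

(* Linear operators S : D(S) \subset X -> Y. The underlying function is total;
   its values outside the domain are irrelevant. *)
Record operator (R : realType) (X Y : normedModType R) := Operator {
  dom : set X;
  op_fun :> X -> Y;
  dom_subspace : is_subspace dom;
  op_linear : forall (a : R) (x y : X), dom x -> dom y ->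
    op_fun (a *: x + y) = a *: op_fun x + op_fun y
}.

Definition graph (R : realType) (X Y : normedModType R) (S : operator X Y) :
    set (X * Y) :=
  [set p | dom S p.1 /\ p.2 = S p.1].

Definition closed_operator (R : realType) (X Y : normedModType R)
  (S : operator X Y) : Prop := closed (graph S).

(* Density of D in D(A) for the graph norm |x| + |A x|. *)
Definition is_core (R : realType) (X : normedModType R) (A : operator X X)
    (D : set X) : Prop :=
  [/\ is_subspace D, D `<=` dom A &
      forall x, dom A x -> forall e : R, 0 < e ->
        exists2 y, D y & `|x - y| + `|A x - A y| < e].

(* Meaningful for bounded linear f only: sup is 0 on unbounded sets. *)
Definition opnorm (R : realType) (X Y : normedModType R) (f : X -> Y) : R :=
  sup [set `|f x| | x in [set x | `|x| <= 1]].

(* Strongly continuous maps V : [0, oo) -> L(X). The values V t at t < 0 are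
   unconstrained; a linear map is bounded iff it is continuous. *)
Definition strongly_continuous (R : realType) (X : normedModType R)
    (V : R -> {linear X -> X}) : Prop :=
  (forall t : R, 0 <= t -> continuous (V t)) /\
  (forall x : X, {within `[0, +oo[%classic, continuous (fun t : R => V t x)}).

Definition C0_semigroup (R : realType) (X : normedModType R)
    (T : R -> {linear X -> X}) : Prop :=
  [/\ strongly_continuous T,
      forall x, T 0 x = x &
      forall s t : R, 0 <= s -> 0 <= t -> forall x, T (s + t) x = T s (T t x)].

Definition diff_quotient (R : realType) (X : normedModType R)
    (V : R -> {linear X -> X}) (x : X) (h : R) : X :=
  h^-1 *: (V h x - x).

Definition is_generator (R : realType) (X : normedModType R)
    (A : operator X X) (T : R -> {linear X -> X}) : Prop :=
  dom A = [set x | cvg (diff_quotient T x h @[h --> 0^'+])] /\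
  forall x, dom A x -> diff_quotient T x h @[h --> 0^'+] --> A x.

Record ordered_space (R : realType) (Y : normedModType R)
    (le : Y -> Y -> Prop) : Prop := OrderedSpace {
  os_refl : forall y, le y y;
  os_anti : forall y z, le y z -> le z y -> y = z;
  os_trans : forall y z w, le y z -> le z w -> le y w;
  os_add : forall y z w, le y z -> le (y + w) (z + w);
  os_scale : forall (a : R) y z, 0 <= a -> le y z -> le (a *: y) (a *: z)
}.

Definition positive_cone (R : realType) (Y : normedModType R)
    (le : Y -> Y -> Prop) : set Y := [set y | le 0 y].

Definition shape_cone (R : realType) (X Y : normedModType R)
    (le : Y -> Y -> Prop) (S : operator X Y) : set X :=
  closure [set x | dom S x /\ le 0 (S x)].

Definition shape_cone_in (R : realType) (X Y : normedModType R)
    (le : Y -> Y -> Prop) (S : operator X Y) (A : operator X X) : set X :=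
  closure [set x | (dom A x /\ dom S x) /\ le 0 (S x)].

(* T is meant to be the semigroup (e^{tA}) generated by A. *)
Definition shape_preserving (R : realType) (X Y : normedModType R)
    (le : Y -> Y -> Prop) (S : operator X Y) (A : operator X X)
    (T : R -> {linear X -> X}) : Prop :=
  shape_cone le S = shape_cone_in le S A /\
  forall t : R, 0 <= t -> T t @` shape_cone le S `<=` shape_cone le S.

(* Main.v *)
(** For x in D(A), T(t)x is a limit of vectors V(h)^n x with nh = t, which stay
    in the closed set C; hence T(t) maps C \cap D(A) into C, and C \cap D(A) is
    dense in C because C = C_A.  The core D need not be T-invariant, so
    consistency is not available along the orbit itself: the orbit is
    approximated in graph norm by a polygon with finitely many vertices in D,
    along which consistency is uniform, and stability is used twice, to sum the
    local errors on each edge and then over the edges. *)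
Require Import Defs.
From mathcomp Require Import all_boot all_order all_algebra.
From mathcomp Require Import all_classical all_reals all_analysis.
From mathcomp Require Import ring lra.
Set Implicit Arguments.
Unset Strict Implicit.

Import Order.TTheory GRing.Theory Num.Theory.
Import numFieldNormedType.Exports.
Local Open Scope classical_set_scope.
Local Open Scope ring_scope.

(** * Operator norms and error propagation under iteration *)

Lemma le_opnorm (R : realType) (X Y : normedModType R) (f : X -> Y) (B : R) :
  scalable f -> (forall x, `|f x| <= B * `|x|) ->
  forall x, `|f x| <= opnorm f * `|x|.
Proof.
move=> fZ fB x; have [->|x0] := eqVneq x 0.
  by rewrite -{1}(scale0r (0 : X)) fZ scale0r !normr0 mulr0.
have nx : 0 < `|x| by rewrite normr_gt0.
rewrite -ler_pdivrMr// mulrC -[`|x|^-1]gtr0_norm ?invr_gt0// -normrZ -fZ.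
apply: ub_le_sup; last first.
  exists (`|x|^-1 *: x) => //=.
  by rewrite normrZ gtr0_norm ?invr_gt0// mulVf// gt_eqF.
(* The bound [fB] makes the set under [sup] bounded, which rules out the default value 0 and makes
   [opnorm f] a true supremum. *)
exists `|B| => _ [z /= z1 <-]; apply: (le_trans (fB z)).
by apply: (le_trans (ler_wpM2r (normr_ge0 z) (ler_norm B))); rewrite ler_piMr.
Qed.

Lemma continuous_linear_le (R : realType) (X Y : normedModType R)
    (f : {linear X -> Y}) :
  continuous f -> exists2 B, 0 <= B & forall x, `|f x| <= B * `|x|.
Proof.
move=> /linear_bounded_continuous/linear_boundedP fB.
have [B [B0 fB']] := filter_ex (filterI (nbhs_pinfty_ge (num_real (0 : R))) fB).
by exists B.
Qed.

Lemma iter_scalable (R : realType) (X : normedModType R) (f : X -> X) n :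
  scalable f -> scalable (iter n f).
Proof. by move=> fZ; elim: n => // n IH a x; rewrite /= IH fZ. Qed.

Lemma iter_morphB (R : realType) (X : normedModType R) (f : X -> X) n :
  {morph f : x y / x - y} -> {morph iter n f : x y / x - y}.
Proof. by move=> fB; elim: n => // n IH x y; rewrite /= IH fB. Qed.

Lemma iter_opnorm (R : realType) (X : normedModType R) (f : {linear X -> X}) n :
  continuous f -> forall x, `|iter n f x| <= opnorm (iter n f) * `|x|.
Proof.
move=> /continuous_linear_le[B B0 fB].
apply: (@le_opnorm _ _ _ _ (B ^+ n)).
  by apply: iter_scalable => a x; rewrite linearZ.
elim: n => [|n IH] x /=; first by rewrite expr0 mul1r.
by apply: (le_trans (fB _)); rewrite exprS -mulrA ler_wpM2l.
Qed.

(** The error is the sum over k < n of L^(n-1-k) (w (k+1) - L (w k)), and each term is amplified by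
    [K] only once because [K] bounds the iterates themselves. [L] stands later both for one step
    [V h] and for a whole edge [iter p (V h)]. *)
Lemma telescoping_error (R : realType) (X : normedModType R) (L : X -> X)
    (K eps : R) (w : nat -> X) (n : nat) :
  {morph L : x y / x - y} -> 0 <= K ->
  (forall j x, (j < n)%N -> `|iter j L x| <= K * `|x|) ->
  (forall k, (k < n)%N -> `|w k.+1 - L (w k)| <= eps) ->
  `|w n - iter n L (w 0%N)| <= n%:R * (K * eps).
Proof.
move=> LB K0; elim: n w => [|n IH] w LK wL.
  by rewrite /= subrr normr0 mul0r.
(* Shifting the sequence splits off the oldest local error, L^n (w 1 - L (w 0)). *)
have := IH (w \o succn) (fun j x jn => LK j x (ltnW jn)) (fun k kn => wL k.+1 kn).
rewrite /= => wn.
have wn1 : `|iter n L (w 1%N) - iter n.+1 L (w 0%N)| <= K * eps.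
  rewrite iterSr -(iter_morphB _ LB); apply: (le_trans (LK _ _ (ltnSn n))).
  by apply: ler_wpM2l => //; exact: wL.
have := ler_distD (iter n L (w 1%N)) (w n.+1) (iter n.+1 L (w 0%N)).
by rewrite -natr1 mulrDl mul1r => /le_trans -> //; exact: lerD.
Qed.

(* Local errors along the polygon w k = y + (k/p)(z - y), whose increment is
   constant. *)
Lemma segment_error (R : realType) (X : normedModType R) (L : {linear X -> X})
    (K eps : R) (y z : X) (p : nat) :
  (0 < p)%N -> 0 <= K ->
  (forall j x, (j < p)%N -> `|iter j L x| <= K * `|x|) ->
  `|p%:R^-1 *: (z - y) - (L y - y)| <= eps ->
  `|p%:R^-1 *: (z - y) - (L z - z)| <= eps ->
  `|z - iter p L y| <= p%:R * (K * eps).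
Proof.
move=> p0 K0 LK ey ez; have pR : (p%:R : R) != 0 by rewrite pnatr_eq0 -lt0n.
pose w k := y + (k%:R / p%:R) *: (z - y).
have -> : z = w p by rewrite /w divff// scale1r addrC subrK.
have w0 : w 0%N = y by rewrite /w mul0r scale0r addr0.
rewrite -[in iter p L y]w0.
apply: telescoping_error => // [x x'|k kp]; first by rewrite linearB.
pose a : R := k%:R / p%:R.
have a0 : 0 <= a by rewrite divr_ge0.
have a1 : 0 <= 1 - a by rewrite subr_ge0 ler_pdivrMr ?mul1r ?ler_nat ?ltr0n// ltnW.
(* The local error is affine in [w k], as the increment is constant. Hence it is the convex
   combination of the errors at [y] and [z], with weights 1 - a and a. *)
have -> : w k.+1 - L (w k) = (1 - a) *: (p%:R^-1 *: (z - y) - (L y - y)) +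
                             a *: (p%:R^-1 *: (z - y) - (L z - z)).
  have -> : L (w k) = L y + a *: (L z - L y).
    by rewrite /w (linearD L) (linearZ_LR L) (linearB L).
  rewrite /w -natr1 mulrDl mul1r -/a.
  move: (L y) (L z) (p%:R^-1 *: (z - y)) (scalerDl (z - y) a p%:R^-1).
  move=> Ly Lz e ->.
  have -> : (1 - a) *: (e - (Ly - y)) + a *: (e - (Lz - z)) =
            (e - (Ly - y)) + (a *: (z - y) - a *: (Lz - Ly)).
    rewrite scalerBl scale1r -addrA [- _ + _]addrC -!scalerBr.
    congr (_ + a *: _).
    by rewrite !opprB addrC addrA subrK addrACA [Ly + z]addrC addrACA.
  rewrite opprD addrACA [in RHS](addrC e) opprB -[in RHS]addrA.
  by congr (_ + _); rewrite (addrC (a *: _)) -addrA.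
apply: (le_trans (ler_normD _ _)); rewrite !normrZ !ger0_norm//.
rewrite -[leRHS]mul1r -[in leRHS](subrK a 1) [leRHS]mulrDl.
by apply: lerD; apply: ler_wpM2l.
Qed.

(** * Uniform estimates along orbits of the semigroup *)

Lemma generator_comm (R : realType) (X : normedModType R) (A : operator X X)
    (T : R -> {linear X -> X}) (s : R) (x : X) :
  C0_semigroup T -> is_generator A T -> 0 <= s -> dom A x ->
  dom A (T s x) /\ A (T s x) = T s (A x).
Proof.
move=> [[Tc _] _ TD] [domA AT] s0 Ax.
have cTs : diff_quotient T (T s x) h @[h --> 0^'+] --> T s (A x).
  have TsA : T s (diff_quotient T x h) @[h --> 0^'+] --> T s (A x).
    exact: (cvg_comp _ _ (AT x Ax) (Tc s s0 (A x))).
  apply: cvg_trans TsA; apply: near_eq_cvg; near=> h.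
  have h0 : 0 <= h by apply/ltW; near: h; exact: nbhs_right_gt.
  by rewrite /diff_quotient linearZ linearB -!TD// (addrC s).
have dTs : dom A (T s x) by rewrite domA; apply/cvg_ex; exists (T s (A x)).
by split=> //; apply: (cvg_unique (@norm_hausdorff _ _) (AT _ dTs) cTs).
Unshelve. all: end_near. Qed.

(** Orbits over the compact interval [0, t] are bounded, so the uniform boundedness principle
    applies; completeness of [X] enters here. *)
Lemma C0_semigroup_bounded (R : realType) (X : completeNormedModType R)
    (T : R -> {linear X -> X}) (t : R) :
  strongly_continuous T ->
  exists2 K, 0 <= K & forall s x, 0 <= s <= t -> `|T s x| <= K * `|x|.
Proof.
move=> [Tc Tsc].
pose F : set (X -> X) := [set f : X -> X | exists2 s, 0 <= s <= t & f = T s :> (X -> X)].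
have bF : forall f, F f -> bounded_fun_norm f /\ linear f.
  move=> f [s /andP[s0 _] ->]; split; last by move=> a x y; rewrite linearP.
  have [B B0 TB] := continuous_linear_le (Tc s s0).
  by move=> r; exists (B * r) => x xr; apply: (le_trans (TB x)); exact: ler_wpM2l.
have pF : pointwise_bounded F.
  move=> x; have : compact [set T s x | s in `[0, t]].
    apply: continuous_compact; last exact: segment_compact.
    apply: continuous_subspaceW (Tsc x) => s /=.
    by rewrite !in_itv/= andbT => /andP[].
  move=> /compact_bounded[B [_ TB]]; exists (B + 1) => f [s st ->].
  by apply: (TB (B + 1)); [rewrite ltrDl|exists s].
have [K FK] := Banach_Steinhauss bF pF 1.
exists `|K| => // s x st; have [->|x0] := eqVneq x 0.
  by rewrite linear0 !normr0 mulr0.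
have nx : 0 < `|x| by rewrite normr_gt0.
rewrite -ler_pdivrMr// mulrC -[`|x|^-1]gtr0_norm ?invr_gt0// -normrZ -linearZ.
apply: (le_trans (FK (T s) _ _ _)); [by exists s| |exact: ler_norm].
by rewrite normrZ gtr0_norm ?invr_gt0// mulVf// gt_eqF.
Qed.

(** Both differences are [T s] applied to their values at s = 0. A uniform bound on [T s] thus gives
    one [d] valid for all s in [0, t], and s + d may exceed t. *)
Lemma orbit_consistency (R : realType) (X : completeNormedModType R)
    (A : operator X X) (T : R -> {linear X -> X}) (t eta : R) (x : X) :
  C0_semigroup T -> is_generator A T -> dom A x -> 0 < eta ->
  \forall d \near 0^'+, forall s, 0 <= s <= t ->
    `|d^-1 *: (T (s + d) x - T s x) - A (T s x)| <= eta /\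
    `|A (T (s + d) x) - A (T s x)| <= eta.
Proof.
move=> hT hA Ax eta0; have [Tsc T0 TD] := hT.
have [K K0 TK] := C0_semigroup_bounded t Tsc.
(* Dividing by K + 1 covers the case K = 0. *)
have e0 : 0 < eta / (K + 1) by rewrite divr_gt0// ltr_wpDl.
have Kle a : a <= eta / (K + 1) -> K * a <= eta.
  move=> ale; apply: (le_trans (ler_wpM2l K0 ale)).
  by rewrite mulrCA ler_piMr 1?ltW// ltr_pdivrMr ?ltr_wpDl// mul1r ltrDl.
have /cvgrPdist_le/(_ _ e0) qA := hA.2 x Ax.
have /cvgrPdist_le/(_ _ e0) TA : T h (A x) @[h --> 0^'+] --> A x.
  by have [_] := (continuous_within_itvcyP 0 _).1 (Tsc.2 (A x)); rewrite T0.
near=> d => s /andP[s0 st].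
have d0 : 0 <= d by apply/ltW; near: d; exact: nbhs_right_gt.
have [_ ATs] := generator_comm hT hA s0 Ax.
have [_ ATsd] := generator_comm hT hA (addr_ge0 s0 d0) Ax.
have sst : 0 <= s <= t by rewrite s0.
rewrite ATs ATsd !TD//; split.
  rewrite -(linearB (T s)) -linearZ -(linearB (T s)).
  apply: (le_trans (TK _ _ sst)); apply: Kle; rewrite distrC.
  by near: d.
rewrite -(linearB (T s)); apply: (le_trans (TK _ _ sst)); apply: Kle; rewrite distrC.
by near: d.
Unshelve. all: end_near. Qed.

(** * Chernoff-type approximation with exact subdivisions of [0, t] *)

Lemma at_right0_divn (R : realType) (P : set R) (t : R) :
  0 < t -> (\forall h \near 0^'+, P h) ->
  exists2 n : nat, (0 < n)%N & P (t / n%:R).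
Proof.
move=> t0 [r /= r0 rP]; have [n tn] : exists n, t / r < n.+1%:R.
  by exists (Num.truncn (t / r)); exact: truncnS_gt.
exists n.+1 => //; apply: rP => /=; last by rewrite divr_gt0.
by rewrite sub0r normrN gtr0_norm ?divr_gt0// ltr_pdivrMr// mulrC -ltr_pdivrMr.
Qed.

(** One pair [h], [n] per [eps] is enough to reach the closure of an invariant set. The proof cuts
    [0, t] into m edges of length d and each edge into p steps of length h, so n = m p and n h =
    t. *)
Lemma chernoff_approx (R : realType) (X : completeNormedModType R)
    (A : operator X X) (T V : R -> {linear X -> X}) (D : set X)
    (M omega t eps : R) (x : X) :
  C0_semigroup T -> is_generator A T ->
  (forall h, 0 <= h -> continuous (V h)) -> 1 <= M ->
  (forall (h : R) (n : nat), 0 <= h ->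
    opnorm (iter n (V h)) <= M * expR (h * n%:R * omega)) ->
  is_core A D ->
  (forall z, D z -> diff_quotient V z h @[h --> 0^'+] --> A z) ->
  0 < t -> dom A x -> 0 < eps ->
  exists h n, 0 <= h /\ `|T t x - iter n (V h) x| < eps.
Proof.
move=> hT hA Vc M1 Vstab [_ DA coreD] Vcons t0 Ax eps0.
have [_ T0 _] := hT.
(* This bounds all iterates up to time t, whatever the sign of [omega]. *)
pose K := M * expR (t * `|omega|).
have K1 : 1 <= K.
  by rewrite /K -[leLHS]mulr1 ler_pM// -expR0 ler_expR mulr_ge0// ltW.
have K0 : 0 < K by exact: lt_le_trans K1.
have VK h j z : 0 <= h -> h * j%:R <= t -> `|iter j (V h) z| <= K * `|z|.
  move=> h0 hj; apply: (le_trans (iter_opnorm j (Vc h h0) z)).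
  apply: ler_wpM2r => //; apply: (le_trans (Vstab h j h0)).
  apply: ler_wpM2l; first exact: le_trans M1.
  rewrite ler_expR; apply: (@le_trans _ _ (h * j%:R * `|omega|)).
    by rewrite ler_wpM2l ?mulr_ge0// ler_norm.
  by rewrite ler_wpM2r.
clearbody K.
(* The m p local errors 5 h eta, amplified by K within an edge and again across edges, total 5 t K^2
   eta = eps / 4. *)
pose eta := eps / (20 * t * (K * K)).
have eta0 : 0 < eta by rewrite /eta divr_gt0// !mulr_gt0.
have [m m0 orb] := at_right0_divn t0 (orbit_consistency t hT hA Ax eta0).
have mR : 0 < m%:R :> R by rewrite ltr0n.
pose d := t / m%:R.
have d0 : 0 < d by rewrite /d divr_gt0.
have dm : m%:R * d = t by rewrite mulrC divfK// gt_eqF.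
(* Vertex tolerance, chosen after d: the terms control, in turn, the error in A, the edge slope
   after division by d, and the two endpoint errors. *)
pose g := Num.min eta (Num.min (d * eta / 2) (eps / (4 * K))).
have g0 : 0 < g.
  by rewrite /g !lt_min eta0 (divr_gt0 (mulr_gt0 d0 eta0))//= divr_gt0// mulr_gt0.
have geta : g <= eta by rewrite /g ge_min lexx.
have gd : 2 * g <= d * eta.
  have : g <= d * eta / 2 by rewrite /g !ge_min lexx orbT.
  lra.
have geps : K * g <= eps / 4.
  have : g <= eps / (4 * K) by rewrite /g !ge_min lexx !orbT.
  by rewrite invfM mulrA ler_pdivlMr// (mulrC g).
pose u i := T (i%:R * d) x.
have Au i : dom A (u i) by apply: (generator_comm hT hA _ Ax).1; rewrite mulr_ge0// ltW.
have [y yP] := choice (fun i => let: ex_intro2 z Dz zP := coreD _ (Au i) _ g0 in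
  ex_intro (fun z => D z /\ `|u i - z| + `|A (u i) - A z| < g) z (conj Dz zP)).
have Dy i : D (y i) by have [] := yP i.
have uy i : `|u i - y i| <= g.
  by have [_ /ltW] := yP i; apply: le_trans; rewrite lerDl.
have Auy i : `|A (u i) - A (y i)| <= g.
  by have [_ /ltW] := yP i; apply: le_trans; rewrite lerDr.
(* Only the m + 1 vertices are tested, so finitely many neighbourhoods of 0 are intersected and one
   step size serves them all. *)
have [p p0 Vy] : exists2 p : nat, (0 < p)%N & forall i : 'I_m.+1,
    `|A (y i) - diff_quotient V (y i) (d / p%:R)| <= eta.
  apply: (@at_right0_divn _ (fun h => forall i : 'I_m.+1,
    `|A (y i) - diff_quotient V (y i) h| <= eta) _ d0).
  apply: filter_forall => i.
  by have /cvgrPdist_le/(_ _ eta0) := Vcons _ (Dy i).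
have pR : 0 < p%:R :> R by rewrite ltr0n.
pose h := d / p%:R.
have h0 : 0 < h by rewrite /h divr_gt0.
have hp : p%:R * h = d by rewrite mulrC divfK// gt_eqF.
have hmp : h * (m * p)%:R = t by rewrite natrM mulrC -mulrA hp.
have step i : (i < m)%N ->
    `|y i.+1 - iter p (V h) (y i)| <= p%:R * (K * (h * (5 * eta))).
  move=> im; have id : 0 <= i%:R * d <= t.
    apply/andP; split; first by apply: mulr_ge0 => //; exact: ltW.
    by rewrite -[leRHS]dm ler_pM2r// ler_nat ltnW.
  have uS : u i.+1 = T (i%:R * d + d) x by rewrite /u -natr1 mulrDl mul1r.
  have [] := orb _ id; rewrite -/d -uS -/(u i) => du Adu.
  have dy : `|d^-1 *: (y i.+1 - y i) - A (u i)| <= 2 * eta.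
    have yu : `|(y i.+1 - y i) - (u i.+1 - u i)| <= 2 * g.
      rewrite opprB (addrC (u i)) addrACA (addrC (- y i)).
      apply: (le_trans (ler_normD _ _)); rewrite distrC.
      by have := uy i; have := uy i.+1; lra.
    have dyu : `|d^-1 *: (y i.+1 - y i) - d^-1 *: (u i.+1 - u i)| <= eta.
      rewrite -scalerBr normrZ gtr0_norm ?invr_gt0// mulrC ler_pdivrMr//.
      by rewrite (mulrC eta); exact: le_trans gd.
    have := ler_distD (d^-1 *: (u i.+1 - u i)) (d^-1 *: (y i.+1 - y i)) (A (u i)).
    lra.
  (* The factor 5: 2 eta from the slope to [A (u i)], 2 eta from there to [A z], and eta for
     consistency at z. The second 2 eta allows for the far vertex, where A also varies along the
     orbit. *)
  have err z : `|A z - diff_quotient V z h| <= eta -> `|A (u i) - A z| <= 2 * eta ->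
      `|p%:R^-1 *: (y i.+1 - y i) - (V h z - z)| <= h * (5 * eta).
    move=> Vz uz.
    have -> : p%:R^-1 *: (y i.+1 - y i) - (V h z - z) =
        h *: (d^-1 *: (y i.+1 - y i) - diff_quotient V z h).
      rewrite /diff_quotient [RHS]scalerBr !scalerA divff ?gt_eqF// scale1r; congr (_ *: _ - _).
      by rewrite /h mulrAC divff ?mul1r// gt_eqF.
    rewrite normrZ gtr0_norm// ler_pM2l//.
    have := ler_distD (A (u i)) (d^-1 *: (y i.+1 - y i)) (diff_quotient V z h).
    have := ler_distD (A z) (A (u i)) (diff_quotient V z h).
    lra.
  apply: segment_error => //; first exact: ltW.
  - move=> j z jp; apply: VK; first exact: ltW.
    rewrite -hmp ler_pM2l// ler_nat; apply: (leq_trans (ltnW jp)).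
    by rewrite leq_pmull.
  - apply: err; first exact: (Vy (Ordinal (ltnW im : (i < m.+1)%N))).
    by apply: (le_trans (Auy i)); lra.
  - apply: err; first exact: (Vy (Ordinal (im : (i.+1 < m.+1)%N))).
    have := ler_distD (A (u i.+1)) (A (u i)) (A (y i.+1)).
    have := Auy i.+1; rewrite distrC in Adu; lra.
exists h, (m * p)%N; split; first exact: ltW.
have main : `|y m - iter (m * p) (V h) (y 0%N)| <= eps / 4.
  rewrite iterM.
  apply: (@le_trans _ _ (m%:R * (K * (p%:R * (K * (h * (5 * eta))))))).
    apply: telescoping_error => //; [|exact: ltW|].
    - by apply: iter_morphB => a b; rewrite linearB.
    - move=> j z jm; rewrite -iterM; apply: VK; first exact: ltW.
      by rewrite -hmp ler_pM2l// ler_nat leq_pmul2r// ltnW.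
  have -> : m%:R * (K * (p%:R * (K * (h * (5 * eta))))) =
      (m%:R * (p%:R * h)) * (5 * K * K * eta) by ring.
  by rewrite hp dm /eta le_eqVlt; apply/orP; left; apply/eqP; field; lra.
have first_err : `|iter (m * p) (V h) (y 0%N) - iter (m * p) (V h) x| <= eps / 4.
  rewrite -iter_morphB; last by move=> a b; rewrite linearB.
  apply: (le_trans (VK _ _ _ _ _)); [exact: ltW|by rewrite hmp|].
  apply: le_trans geps; rewrite ler_pM2l//.
  by have := uy 0%N; rewrite /u mul0r T0 distrC.
have last_err : `|T t x - y m| <= eps / 4.
  have := uy m; rewrite /u dm => /le_trans; apply; apply: le_trans geps.
  by rewrite ler_peMl// ltW.
(* Three errors of at most eps / 4 leave room for the strict inequality. *)
have := ler_distD (y m) (T t x) (iter (m * p) (V h) x).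
have := ler_distD (iter (m * p) (V h) (y 0%N)) (y m) (iter (m * p) (V h) x).
lra.
Qed.

Unset Implicit Arguments.

Theorem theorem3p2 (R : realType) (X Y : completeNormedModType R)
    (le : Y -> Y -> Prop) (S : operator X Y) (A : operator X X)
    (T V : R -> {linear X -> X}) (D : set X) (M omega : R)
    (hle : ordered_space le) (hcone : closed (positive_cone le))
    (hS : closed_operator S)
    (hT : C0_semigroup T) (hA : is_generator A T)
    (hV : strongly_continuous V)
    (hM : 1 <= M)
    (hstab : forall (t : R) (n : nat), 0 <= t ->
       opnorm (iter n (V t)) <= M * expR (t * n%:R * omega))
    (hD : is_core A D)
    (hcons : forall x, D x -> diff_quotient V x h @[h --> 0^'+] --> A x)
    (hC : shape_cone le S = shape_cone_in le S A)
    (hVC : forall t : R, 0 <= t -> V t @` shape_cone le S `<=` shape_cone le S) :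
  shape_preserving le S A T.
Proof.
split=> // t t0; have [[Tc _] T0 _] := hT; have [Vc _] := hV.
have clC : closed (shape_cone le S) by exact: closed_closure.
have CD x : dom A x -> shape_cone le S x -> shape_cone le S (T t x).
  move=> Ax Cx; have [->|tn0] := eqVneq t 0; first by rewrite T0.
  have tgt0 : 0 < t by rewrite lt_def tn0.
  apply: clC => B /nbhs_ballP[e /= e0 eB].
  have [h [n [h0 Tx]]] := chernoff_approx hT hA Vc hM hstab hD hcons tgt0 Ax e0.
  exists (iter n (V h) x); split; last by apply: eB; rewrite -ball_normE.
  elim: n {Tx} => //= n IH; apply: (hVC h h0).
  by exists (iter n (V h) x).
(* For general x in C, the preimage of B under the continuous [T t] is a neighbourhood of x. By [hC]
   it contains some z in D(A) with S z >= 0, to which [CD] applies. *)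
move=> _ [x Cx <-]; apply: clC => B /(Tc t t0 x) xB.
move: Cx; rewrite {1}hC => /(_ _ xB)[z [[[Az Sz] Sz0] zB]].
exists (T t z); split=> //; apply: CD => //.
by apply: subset_closure.
Qed.
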